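(* For every integer $k\geq 0$, the curve $\mathcal{S}_{k,1}\subset \mathcal{P}_3$, consisting of the affine conjugacy classes of cubic polynomials having a critical point that is preperiodic to a fixed point with preperiod $k$, is irreducible.
   Context: For a rational map $f:\mathbb{C}\mathbb{P}^1\to\mathbb{C}\mathbb{P}^1$, a point $z$ is periodic with period $n\geq 1$ if $f^{\circ n}(z)=z$ and $n$ is the least such integer; $z$ is preperiodic with preperiod $k\geq 0$ if $f^{\circ k}(z)$ is periodic and $k$ is the least such integer. A point is preperiodic to a cycle of period $n$ with preperiod $k$ if it is preperiodic with preperiod $k$ and $f^{\circ k}(z)$ has period $n$ (for $n=1$: preperiodic to a fixed point; here the fixed point is a finite point of $\mathbb{C}$). $\mathcal{P}_3$ is the moduli space of affine conjugacy classes of cubic polynomials with complex coefficients; it is isomorphic to $\mathbb{C}^2$ (every cubic polynomial is affine conjugate to some $z^3+Az+B$, and the class is determined by $(A,B^2)\in\mathbb{C}^2$). For $k\geq 0$ and $n\geq 1$, $\mathcal{S}_{k,n}\subset\mathcal{P}_3$ denotes the set of classes of cubic polynomials that have a critical point in $\mathbb{C}$ preperiodic to a cycle of period $n$ with preperiod $k$. Irreducible means irreducible for the topology induced by the Zariski topology of $\mathcal{P}_3\cong\mathbb{C}^2$: $\mathcal{S}_{k,1}$ is nonempty and is not the union of two proper relatively Zariski-closed subsets. *)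

(* Defs.v *)
From HB Require Import structures.
From mathcomp Require Import all_boot all_order all_algebra.
From mathcomp Require Import generic_quotient ring.
From mathcomp Require Import boolp classical_sets reals.
From mathcomp Require Import complex.

Set Implicit Arguments.
Unset Strict Implicit.
Unset Printing Implicit Defensive.

Import GRing.Theory.
Local Open Scope ring_scope.
Local Open Scope quotient_scope.
Local Open Scope classical_set_scope.

Definition has_period (T : Type) (f : T -> T) (n : nat) (z : T) : Prop :=
  [/\ (1 <= n)%N, iter n f z = z &
      forall m, (1 <= m < n)%N -> iter m f z <> z].

Definition periodic (T : Type) (f : T -> T) (z : T) : Prop :=
  exists n, has_period f n z.

Definition has_preperiod (T : Type) (f : T -> T) (k : nat) (z : T) : Prop :=
  periodic f (iter k f z) /\
  forall j, (j < k)%N -> ~ periodic f (iter j f z).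

Definition preperiodic_to_cycle (T : Type) (f : T -> T) (k n : nat) (z : T) :
    Prop :=
  has_preperiod f k z /\ has_period f n (iter k f z).

Definition cubic (R : realType) := {p : {poly R[i]} | size p == 4%N}.

(* q = L o p o L^-1 for the affine automorphism L(z) = a z + b. *)
Definition affine_conj (R : realType) (p q : {poly R[i]}) : Prop :=
  exists a b : R[i], a != 0 /\
    q \Po (a *: 'X + b%:P) = (a *: 'X + b%:P) \Po p.

Definition cubic_conj (R : realType) : rel (cubic R) :=
  fun p q => `[< affine_conj (val p) (val q) >].

Lemma cubic_conj_refl (R : realType) : reflexive (@cubic_conj R).
Proof.
move=> p; apply/asboolP; exists 1, 0; split; first exact: oner_neq0.
by rewrite scale1r addr0 comp_polyXr comp_polyX.
Qed.

Lemma affine_conj_sym (R : realType) (p q : {poly R[i]}) :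
  affine_conj p q -> affine_conj q p.
Proof.
move=> [a [b [a0 e]]]; exists a^-1, (- (a^-1 * b)).
set L := a *: 'X + b%:P in e *; set M := a^-1 *: 'X + _.
have LM : L \Po M = 'X.
  rewrite /L /M.
  rewrite comp_polyD comp_polyZ comp_polyX comp_polyC scalerDr scalerA divff//.
  by rewrite scale1r -mul_polyC -polyCM mulrN mulrA divff// mul1r polyCN addrNK.
have ML : M \Po L = 'X.
  rewrite /L /M.
  rewrite comp_polyD comp_polyZ comp_polyX comp_polyC scalerDr scalerA mulVf//.
  by rewrite scale1r -mul_polyC -polyCM polyCN addrK.
split; first by rewrite invr_eq0.
rewrite -[in RHS](comp_polyXr q) -LM (comp_polyA q) e.
by rewrite -(comp_polyA L p M) (comp_polyA M L) ML comp_polyX.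
Qed.

Lemma affine_conj_trans (R : realType) (p q r : {poly R[i]}) :
  affine_conj p q -> affine_conj q r -> affine_conj p r.
Proof.
move=> [a [b [a0 e1]]] [c [d [c0 e2]]]; exists (c * a), (c * b + d).
split; first by rewrite mulf_neq0.
have -> : (c * a) *: 'X + (c * b + d)%:P =
    (c *: 'X + d%:P) \Po (a *: 'X + b%:P).
  rewrite comp_polyD comp_polyZ comp_polyX comp_polyC scalerDr scalerA.
  by rewrite -(mul_polyC c b%:P) polyCD polyCM addrA.
by rewrite comp_polyA e2 -comp_polyA e1 comp_polyA.
Qed.

Lemma cubic_conj_sym (R : realType) : symmetric (@cubic_conj R).
Proof. by move=> p q; apply/asboolP/asboolP; exact: affine_conj_sym. Qed.

Lemma cubic_conj_trans (R : realType) : transitive (@cubic_conj R).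
Proof.
by move=> q p r /asboolP h1 /asboolP h2; apply/asboolP/(affine_conj_trans h1).
Qed.

Canonical cubic_conj_equiv (R : realType) : equiv_rel (cubic R) :=
  EquivRel (@cubic_conj R) (@cubic_conj_refl R) (@cubic_conj_sym R)
    (@cubic_conj_trans R).

Definition P3 (R : realType) := {eq_quot (@cubic_conj_equiv R)}.

Definition P3_class (R : realType) (p : cubic R) : P3 R :=
  \pi_({eq_quot (@cubic_conj_equiv R)}) p.

Lemma P3_classP (R : realType) (p q : cubic R) :
  P3_class p = P3_class q <-> affine_conj (val p) (val q).
Proof.
split=> [/eqP|h]; first by rewrite eqmodE => /asboolP.
by apply/eqP; rewrite eqmodE; apply/asboolP.
Qed.

Lemma P3_classK (R : realType) (c : P3 R) : exists p, P3_class p = c.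
Proof. by exists (repr c); rewrite /P3_class reprK. Qed.

Lemma size_centered (R : realType) (A B : R[i]) :
  size ('X^3 + A *: 'X + B%:P) == 4%N.
Proof.
rewrite -addrA size_polyDl size_polyXn //.
rewrite (leq_ltn_trans (size_polyD _ _)) // gtn_max.
rewrite (leq_ltn_trans (size_scale_leq _ _)) ?size_polyX //.
by rewrite (leq_ltn_trans (size_polyC_leq1 _)).
Qed.

Definition centered (R : realType) (A B : R[i]) : cubic R :=
  Sub ('X^3 + A *: 'X + B%:P) (size_centered A B).

(* The next two lemmas say that (A, B^2) are well-defined coordinates that
   identify P3 with C^2. *)
Lemma P3_centered (R : realType) (c : P3 R) :
  exists A B, c = P3_class (centered A B).
Proof.
have [p <-] := P3_classK c.
case: p => p sp; have sp4 := eqP sp.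
set a := p`_3; set b := p`_2; set e := p`_1; set d := p`_0.
have a0 : a != 0.
  have : lead_coef p != 0 by rewrite lead_coef_eq0 -size_poly_gt0 sp4.
  by rewrite lead_coefE sp4.
have pE : p = a *: 'X^3 + b *: 'X^2 + e *: 'X + d%:P.
  rewrite -[LHS]coefK sp4 poly_def !big_ord_recl big_ord0 /= addr0.
  by rewrite /bump /= expr1 -!mul_polyC; ring.
have n3 : (3%:R : R[i]) != 0 by rewrite Num.Theory.pnatr_eq0.
pose s := sqrtc a; have s2 : a = s ^+ 2 by rewrite sqr_sqrtc.
have s0 : s != 0 by apply: contraNneq a0 => s0; rewrite s2 s0 expr0n.
pose t := b / (3%:R * a).
have bE : b = 3%:R * s ^+ 2 * t by rewrite /t -s2; field.
pose A := e - 3%:R * s ^+ 2 * t ^+ 2.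
exists A, (s * (d + t) - s ^+ 3 * t ^+ 3 - A * s * t).
apply/P3_classP; exists s, (s * t); split=> //=.
rewrite pE bE s2 /A !(comp_polyD, comp_polyZ, comp_polyC, comp_polyX, comp_Xn_poly).
by rewrite -!mul_polyC; ring.
Qed.

Lemma P3_centered_eq (R : realType) (A B A' B' : R[i]) :
  P3_class (centered A B) = P3_class (centered A' B') <->
  A = A' /\ B ^+ 2 = B' ^+ 2.
Proof.
rewrite P3_classP /=; split.
  move=> [a [b [a0 h]]].
  have {h} : (a ^+ 3 - a) *: 'X^3 + (3%:R * a ^+ 2 * b) *: 'X^2 +
     (3%:R * a * b ^+ 2 + A' * a - a * A) *: 'X +
     (b ^+ 3 + A' * b + B' - a * B - b)%:P = 0 :> {poly R[i]}.
    move/eqP: h; rewrite -subr_eq0 => /eqP <-.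
    rewrite !(comp_polyD, comp_polyZ, comp_polyC, comp_polyX, comp_Xn_poly).
    by rewrite -!mul_polyC; ring.
  move=> /polyP h.
  have := h 3; have := h 2%N; have := h 1%N; have := h 0%N.
  rewrite !(coefD, coefZ, coefC, coefXn, coefX, coef0) /=.
  rewrite !(mulr0, mulr1, addr0, add0r) => h0 h1 h2 h3.
  have b0 : b = 0.
    apply/eqP; move/eqP: h2; rewrite !mulf_eq0 (negPf a0).
    by rewrite Num.Theory.pnatr_eq0.
  move: h0 h1; rewrite b0 => h0 h1.
  have a2 : a ^+ 2 = 1.
    apply: (mulfI a0); rewrite mulr1 -exprS; apply/eqP.
    by rewrite -subr_eq0 h3.
  split.
    apply/(mulfI a0)/esym/eqP; rewrite -subr_eq0 -[X in _ == X]h1; apply/eqP.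
    by ring.
  have -> : B' = a * B by apply/eqP; rewrite -subr_eq0 -[X in _ == X]h0; apply/eqP; ring.
  by rewrite exprMn a2 mul1r.
move=> [-> /eqP]; rewrite eqf_sqr => /orP[] /eqP ->.
  exists 1, 0; split; first exact: oner_neq0.
  by rewrite scale1r addr0 comp_polyXr comp_polyX.
exists (-1), 0; split; first by rewrite oppr_eq0 oner_neq0.
rewrite !(comp_polyD, comp_polyZ, comp_polyC, comp_polyX, comp_Xn_poly).
by rewrite -!mul_polyC; ring.
Qed.

(* The Zariski topology of C^2 transported to P3 along the coordinates
   (A, B^2).  F : {poly {poly C}} is a polynomial in two variables; F.[v%:P].[u] is its
   value with inner variable u and outer variable v. *)
Definition zariski_closed (R : realType) (Z : set (P3 R)) : Prop :=
  exists I : set {poly {poly R[i]}}, forall A B : R[i],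
    Z (P3_class (centered A B)) <->
    forall F, I F -> F.[(B ^+ 2)%:P].[A] = 0.

Definition relatively_closed (R : realType) (S Y : set (P3 R)) : Prop :=
  exists2 Z, zariski_closed Z & Y = S `&` Z.

Definition zariski_irreducible (R : realType) (S : set (P3 R)) : Prop :=
  S !=set0 /\
  ~ exists Y1 Y2 : set (P3 R),
      [/\ relatively_closed S Y1, relatively_closed S Y2,
          Y1 `<` S, Y2 `<` S & S = Y1 `|` Y2].

Definition critical_point (R : realType) (p : {poly R[i]}) (z : R[i]) : Prop :=
  root p^`() z.

(* Polynomials fix infinity and preserve C, so orbits of points of C may be
   computed in C. *)
Definition preperiodic_locus (R : realType) (k n : nat) : set (P3 R) :=
  [set c | exists p : cubic R, c = P3_class p /\
     exists z, critical_point (val p) z /\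
       preperiodic_to_cycle (horner (val p)) k n z].
Arguments preperiodic_locus R k n : clear implicits.

(* Main.v *)
Require Import Defs.
From mathcomp Require Import reals.
From HB Require Import structures.
From mathcomp Require Import all_boot all_order all_algebra ring zify.
From mathcomp Require Import boolp classical_sets complex.

Set Implicit Arguments.
Unset Strict Implicit.
Unset Printing Implicit Defensive.

Import Order.TTheory GRing.Theory Num.Theory.
Local Open Scope ring_scope.

(** Translating a critical point to [0] and conjugating turns a cubic
polynomial with a marked critical point into [w^3 + 3 a w^2 + b].  The orbit of
[0] is then [x_n = b y_n], with [y_n] a polynomial in [a] and [b] defined by
[y_0 = 0] and [y_{n+1} = b^2 y_n^3 + 3 a b y_n^2 + 1].  Factoring
[f(x) - f(x')] gives
[x_{n+2} - x_{n+1} = b (x_{n+1} - x_n) g_n], where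
[g_n = b (y_{n+1}^2 + y_{n+1} y_n + y_n^2) + 3 a (y_{n+1} + y_n)],
so that the marked critical point has preperiod [n+1] to a fixed point exactly
when [g_n = 0] and [x_{n+1} <> x_n].  Preperiod [0] is the line [b = 0].  The
locus in moduli space is therefore the image of the plane curve [g_n = 0], with
finitely many points removed, under a polynomial map, and everything reduces to
the irreducibility of [g_n] over the complex numbers.

Irreducibility over the rationals is arithmetic.  Modulo [3] the recursion
becomes [x_{n+1} = x_n^3 + b], whence [g_n = b^(2 3^n - 1)]
([prefixed_poly_char3]), while [g_n] is monic in [b] and its constant
coefficient is [3 a] or [6 a] ([prefixed_poly_at0]), a multiple of [3] but not
of [9].  Hence [g_n] is an Eisenstein polynomial in [b] over [Z[a]] at the
prime [3] ([eisenstein]).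

Passing to the complex numbers uses that the origin is a smooth rational point
of the curve ([fract_irreducible_extension]).  There the curve is the graph of
a power series [beta(a)] with rational coefficients.  If [g_n] had a proper
factorization over the complex numbers, one factor would vanish along [beta].
Applying a rational linear form to the coefficients of this factor yields a
nonzero polynomial over the rationals that also vanishes along [beta] and has
smaller degree in [b] than [g_n], which the irreducibility over the rationals
forbids.  Power series are replaced by polynomials modulo large powers of [a].

An irreducible [g] that does not divide [G] satisfies a Bezout relation
[U g + V G = r] with [r] a nonzero polynomial in [a] alone
([dvd_or_coprime]).  Such relations can be multiplied
([generically_coprimeM]), and on the curve [g = 0], which projects onto the
[a]-axis because [g] is monic in [b], they produce a point where finitely many
given polynomials are simultaneously nonzero ([irreducible_curve]).  This is
irreducibility in the Zariski sense, and it descends to the image in moduli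
space ([zariski_irreducible_param]). *)

(** * Irreducibility over a fraction field *)

(** Irreducibility over the fraction field of [A], with the denominators of a
factorization collected in [c]. *)
Definition fract_irreducible (A : idomainType) (g : {poly A}) : Prop :=
  forall (c : A) (P Q : {poly A}), c != 0 -> c *: g = P * Q ->
  (size P < size g)%N -> (size Q < size g)%N -> False.

(** Coprimality over the fraction field of [A], as a Bezout relation that can be
evaluated at points. *)
Definition generically_coprime (A : idomainType) (g P : {poly A}) : Prop :=
  exists U V (r : A), r != 0 /\ r%:P = U * g + V * P.

Lemma generically_coprime1 (A : idomainType) (g : {poly A}) :
  generically_coprime g 1.
Proof. by exists 0, 1, 1; rewrite oner_neq0 mul0r mul1r add0r. Qed.

(** Multiply the two Bezout relations. *)
Lemma generically_coprimeM (A : idomainType) (g P Q : {poly A}) :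
  generically_coprime g P -> generically_coprime g Q ->
  generically_coprime g (P * Q).
Proof.
move=> [U [V [r [rN0 rE]]]] [U' [V' [r' [r'N0 r'E]]]].
exists (U * U' * g + U * V' * Q + V * U' * P), (V * V'), (r * r').
by rewrite mulf_neq0 //; split => //; rewrite polyCM rE r'E; ring.
Qed.

(** After division by the monic [g] one may assume that [G] has smaller degree.
The resultant then lies in the ideal of [g] and [G], and its vanishing would
give a common factor of positive degree, that is, a factorization of [g]. *)
Lemma dvd_or_coprime (A : idomainType) (g G : {poly A}) :
  g \is monic -> (1 < size g)%N -> fract_irreducible g ->
  (exists q, G = q * g) \/ generically_coprime g G.
Proof.
move=> gm g1 irr; pose q := Pdiv.Ring.rdivp G g.
have Gdiv := Pdiv.RingMonic.rdivp_eq gm G; rewrite -/q in Gdiv.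
set r0 := Pdiv.Ring.rmodp G g in Gdiv.
have [r00|r0N0] := eqVneq r0 0; first by left; exists q; rewrite Gdiv r00 addr0.
right.
suff [U [V [r [rN0 rE]]]] : generically_coprime g r0.
  exists (U - V * q), V, r; split => //.
  by rewrite rE Gdiv mulrDr mulrBl !mulrA addrA subrK.
have r0g : (size r0 < size g)%N.
  by rewrite Pdiv.Ring.ltn_rmodpN0 // -size_poly_gt0 ltnW.
have [r01|r01] := leqP (size r0) 1.
  exists 0, 1, r0`_0; rewrite mul0r add0r mul1r -size1_polyC //; split=> //.
  by apply: contraNneq r0N0 => e; rewrite (size1_polyC r01) e.
have [[U V] /= _ UV] := resultant_in_ideal g1 r01.
exists U, V, (resultant g r0); split => //.
rewrite resultant_eq0 -leqNgt leqNgt; apply/negP => P1.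
set P := gcdp g r0 in P1.
have Pr : P %| r0 := dvdp_gcdr _ _.
have [[c Q] /= cN0 cE] := Pdiv.Idomain.dvdpP _ _ (dvdp_gcdl g r0).
have Pg : (size P < size g)%N := leq_ltn_trans (dvdp_leq r0N0 Pr) r0g.
have QN0 : Q != 0.
  apply: contra_neq cN0 => Q0; move: cE; rewrite Q0 mul0r => /eqP.
  rewrite scale_poly_eq0 => /orP[/eqP //|/eqP g0].
  by rewrite g0 size_poly0 in g1.
have PN0 : P != 0 by rewrite -size_poly_gt0 ltnW.
apply: (irr c Q P cN0 cE) => //.
rewrite -(size_scale g cN0) cE size_mul // -/P.
by case: (size P) P1 => [|[|n]] // _; rewrite !addnS /= ltnS leq_addr.
Qed.

Lemma poly_divisible (A B : idomainType) (f : {rmorphism A -> B}) (w : A) :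
  (forall a, f a = 0 -> exists a', a = w * a') ->
  forall p : {poly A}, map_poly f p = 0 -> exists p', p = w *: p'.
Proof.
move=> kerf; elim/poly_ind => [|p c IH] pc0.
  by exists 0; rewrite scaler0.
have coefs i := congr1 (fun p : {poly B} => p`_i) pc0.
have c0 : f c = 0.
  by have := coefs 0; rewrite coef_map coefD coefMX coefC coef0 /= add0r.
have p0 : map_poly f p = 0.
  apply/polyP => i; have := coefs i.+1.
  by rewrite !coef_map coefD coefMX coefC /= addr0 !coef0.
have [p' ->] := IH p0; have [c' ->] := kerf c c0.
by exists (p' * 'X + c'%:P); rewrite scalerDr scalerAl polyCM mul_polyC.
Qed.

(** Eisenstein's criterion at the prime [w], whose residue map is [f].  If [w]
does not divide [c], reduce [c *: g = P * Q] modulo [w]: neither factor can have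
a nonzero constant term, since the other one, of degree less than [N], would
then be divisible by ['X^N]; so [w ^ 2] divides the constant term of [c *: g],
against [f e != 0].  If [w] divides [c], it divides [P] or [Q] and can be
cancelled; the measure [mu] makes this descent stop. *)
Lemma eisenstein (A B : idomainType) (f : {rmorphism A -> B}) (w : A)
    (mu : A -> nat) (g : {poly A}) (N : nat) (e : A) :
  (forall a, f a = 0 -> exists a', a = w * a') ->
  f w = 0 -> w != 0 ->
  (forall a, a != 0 -> (mu a < mu (w * a)%R)%N) ->
  g \is monic -> size g = N.+1 -> map_poly f g = 'X^N ->
  g.[0] = w * e -> f e != 0 ->
  fract_irreducible g.
Proof.
move=> kerf fw wN0 mulw gm sg mg g0 fe c.
have [n] := ubnP (mu c); elim: n c => // n IH c mc P Q cN0 cE sP sQ.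
have cmE : (f c) *: 'X^N = map_poly f P * map_poly f Q.
  by rewrite -rmorphM -cE /= map_polyZ /= mg.
have [fc0|fcN0] := eqVneq (f c) 0; last first.
  have root0 P' Q' : c *: g = P' * Q' -> (size Q' < size g)%N ->
      f P'.[0] = 0.
    move=> cE' sQ'; apply/eqP/negPn/negP => fP.
    have cmE' : (f c) *: 'X^N = map_poly f P' * map_poly f Q'.
      by rewrite -rmorphM -cE' /= map_polyZ /= mg.
    have QN0 : map_poly f Q' != 0.
      apply/eqP => Q0; move: cmE'; rewrite Q0 mulr0 => /eqP.
      by rewrite scale_poly_eq0 (negPf fcN0) expf_eq0 polyX_eq0 andbF.
    have [m [Q1 Q1r QE]] := multiplicity_XsubC (map_poly f Q') 0.
    rewrite QN0 /= in Q1r; rewrite subr0 in QE.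
    have Q1N0 : Q1 != 0 by apply: contraNneq QN0 => q; rewrite QE q mul0r.
    have mN : (m < N)%N.
      have : (size (map_poly f Q') <= N)%N.
        by rewrite -ltnS -sg; apply: leq_ltn_trans sQ'; exact: size_poly.
      rewrite QE size_mulXn // => h; apply: leq_trans h.
      by rewrite -addn1 leq_add2l size_poly_gt0.
    move: cmE'; rewrite QE mulrA -(subnK (ltnW mN)) exprD scalerAl.
    move/mulIf => /(_ _); rewrite expf_eq0 polyX_eq0 andbF => /(_ isT).
    move/(congr1 (fun p => p.[0])).
    rewrite hornerZ hornerXn expr0n subn_eq0 leqNgt mN /= mulr0 hornerM.
    have -> : (map_poly f P').[0] = f P'.[0] by rewrite -horner_map rmorph0.
    move/eqP; rewrite eq_sym mulf_eq0 (negPf fP) /=.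
    by rewrite (negPf Q1r : (_ == _) = false).
  have [p' Pp] := kerf _ (root0 _ _ cE sQ).
  have [q' Qq] : exists a', Q.[0] = w * a'.
    by apply: kerf; apply: (root0 Q P); rewrite // mulrC.
  move/(congr1 (fun p => p.[0])): cE.
  rewrite hornerZ hornerM Pp Qq g0 mulrCA -mulrA => /(mulfI wN0).
  rewrite [RHS]mulrCA => /(congr1 f); rewrite !rmorphM fw mul0r => /eqP.
  by rewrite mulf_eq0 (negPf fcN0) (negPf fe).
have [c' cc'] := kerf _ fc0.
have c'N0 : c' != 0 by apply: contraNneq cN0 => h; rewrite cc' h mulr0.
have {}mc : (mu c' < n)%N.
  by rewrite cc' ltnS in mc; apply: leq_trans mc; exact: mulw.
have wI : injective (fun p : {poly A} => w *: p).
  move=> p q /eqP; rewrite -subr_eq0 -scalerBr scale_poly_eq0 (negPf wN0).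
  by rewrite subr_eq0 => /eqP.
move: cmE; rewrite fc0 scale0r => /esym/eqP; rewrite mulf_eq0 => /orP[] /eqP h.
  have [P' PE] := poly_divisible kerf h.
  apply: (IH c' mc P' Q c'N0) => //; last by rewrite PE size_scale in sP.
  by apply: wI; rewrite scalerA -cc' cE PE scalerAl.
have [Q' QE] := poly_divisible kerf h.
apply: (IH c' mc P Q' c'N0) => //; last by rewrite QE size_scale in sQ.
by apply: wI; rewrite scalerA -cc' cE QE scalerAr.
Qed.

(** * Irreducibility under field extension *)

(** Take a subspace [W] maximal among those not containing [c], by Zorn's lemma.
Every vector is congruent modulo [W] to a unique multiple of [c], and this
multiple is the value of the form.  The empty union in Zorn's lemma is the
reason why [stable] does not ask for [0] in the subset. *)
Lemma exists_linear_form (K L : fieldType) (f : {rmorphism K -> L}) (c : L) :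
  c != 0 ->
  exists phi : {additive L -> K},
    (forall x k, phi (x * f k) = phi x * k) /\ phi c != 0.
Proof.
move=> cN0.
pose stable (W : set L) := forall x y k, W x -> W y -> W (x + y * f k).
have [F PF Ftot|W [[Wst Wc] Wmax]] :=
    @Zorn_bigcup L (fun W => stable W /\ ~ W c).
  split; last by move=> [W FW]; have [_] := PF W FW.
  move=> x y k [W1 FW1 W1x] [W2 FW2 W2y].
  have [/(_ _ W1x) W2x|/(_ _ W2y) W1y] := Ftot _ _ FW1 FW2.
    by exists W2 => //; have [st _] := PF _ FW2; exact: st.
  by exists W1 => //; have [st _] := PF _ FW1; exact: st.
pose W0 : set L := fun x => W x \/ x = 0.
have W0st : stable W0.
  move=> x y k [Wx|->] [Wy|->].
  - by left; exact: Wst.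
  - by left; rewrite mul0r addr0.
  - left; have -> : 0 + y * f k = y + y * f (k - 1).
      by rewrite rmorphB rmorph1; ring.
    exact: Wst.
  - by right; rewrite mul0r addr0.
have WW0 : W = W0.
  apply/seteqP; split; first by left.
  apply: contrapT => nsub; apply: (Wmax W0); last first.
    by split => // -[//|c0]; rewrite c0 eqxx in cN0.
  by split => //; left.
have W00 : W 0 by rewrite WW0; right.
have dec x : exists k, W (x - c * f k).
  have [Wx|nWx] := pselect (W x).
    by exists 0; rewrite rmorph0 mulr0 subr0.
  pose W1 : set L := fun z => exists w k, W w /\ z = w + x * f k.
  have st1 : stable W1.
    move=> _ _ k [w1 [k1 [Ww1 ->]]] [w2 [k2 [Ww2 ->]]].
    exists (w1 + w2 * f k), (k1 + k2 * k); split; first exact: Wst.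
    by rewrite rmorphD rmorphM; ring.
  have [w [k [Ww ck]]] : W1 c.
    apply: contrapT => nc; apply: (Wmax W1) => //; split.
      by move=> w Ww; exists w, 0; split => //; rewrite rmorph0 mulr0 addr0.
    move=> W1W; apply: nWx; apply: W1W; exists 0, 1; split => //.
    by rewrite rmorph1 mulr1 add0r.
  have kN0 : k != 0.
    apply: contraPneq Ww => k0; rewrite k0 rmorph0 mulr0 addr0 in ck.
    by rewrite -ck.
  exists k^-1; have -> : x - c * f k^-1 = 0 + w * f (- k^-1).
    by rewrite ck fmorphV rmorphN fmorphV; field; rewrite fmorph_eq0.
  exact: Wst.
have uniq k : W (c * f k) -> k = 0.
  move=> Wk; apply/eqP/negPn/negP => kN0; apply: Wc.
  have -> : c = 0 + (c * f k) * f k^-1.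
    by rewrite fmorphV add0r mulfK // fmorph_eq0.
  exact: Wst.
have WB x y : W x -> W y -> W (x - y).
  by move=> Wx Wy; have := Wst _ _ (-1) Wx Wy; rewrite rmorphN1 mulrN1.
pose phi x := projT1 (cid (dec x)).
have phiW x : W (x - c * f (phi x)) := projT2 (cid (dec x)).
have phiE x k : W (x - c * f k) -> phi x = k.
  move=> Wx; apply/eqP; rewrite -subr_eq0; apply/eqP/uniq.
  have -> : c * f (phi x - k) = (x - c * f k) - (x - c * f (phi x)).
    by rewrite rmorphB; ring.
  exact: WB.
have phiB : zmod_morphism phi.
  move=> x y; apply: phiE.
  have -> : x - y - c * f (phi x - phi y) =
      (x - c * f (phi x)) - (y - c * f (phi y)) by rewrite rmorphB; ring.
  exact: WB.
pose phiA := GRing.isZmodMorphism.Build L K phi phiB.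
pose phi' : {additive L -> K} := HB.pack phi phiA.
exists phi'; split.
  move=> x k; apply: phiE; rewrite rmorphM.
  have -> : x * f k - c * (f (phi x) * f k) =
    0 + (x - c * f (phi x)) * f k by ring.
  exact: Wst.
have -> : phi' c = 1 by apply: phiE; rewrite rmorph1 mulr1 subrr.
exact: oner_neq0.
Qed.

Section Semilinear.
Variables (A B : comNzRingType) (h : {rmorphism A -> B}).
Variable phi : {additive B -> A}.
Hypothesis phiM : forall b a, phi (b * h a) = phi b * a.

Lemma semilinear_map_poly p q :
  map_poly phi (p * map_poly h q) = map_poly phi p * q.
Proof.
apply/polyP => i; rewrite coef_map_id0 ?raddf0 // !coefM raddf_sum.
by apply: eq_bigr => j _; rewrite !coef_map_id0 ?raddf0 ?rmorph0.
Qed.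

Lemma semilinear_horner (P : {poly B}) a :
  (map_poly phi P).[a] = phi P.[h a].
Proof.
rewrite (@horner_coef_wide _ (size P)) ?size_poly // horner_coef raddf_sum.
by apply: eq_bigr => i _; rewrite coef_map_id0 ?raddf0 // -rmorphXn phiM.
Qed.
End Semilinear.

Lemma horner_horner (A : comNzRingType) (P : {poly {poly A}}) q u :
  (P.[q]).[u] = (P.[(q.[u])%:P]).[u].
Proof.
elim/poly_ind: P => [|P c IH]; first by rewrite !horner0.
by rewrite !hornerE IH.
Qed.

Lemma horner_taylor2 (A : comNzRingType) (P : {poly A}) x d :
  exists h, P.[x + d] = P.[x] + P^`().[x] * d + h * d ^+ 2.
Proof.
elim/poly_ind: P => [|P c [h IH]].
  by exists 0; rewrite deriv0 !horner0 !mul0r !addr0.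
exists (P^`().[x] + h * x + h * d).
by rewrite derivMXaddC !(hornerD, hornerM, hornerX, hornerC) IH; ring.
Qed.

Lemma dvdX (K : fieldType) (p : {poly K}) : ('X %| p) = (p.[0] == 0).
Proof. by rewrite -['X]subr0 dvdp_XsubCl. Qed.

(** Newton's iteration with the constant slope [g^`().[0].[0]]: each step gains
one power of ['X], starting from the approximate root [0]. *)
Lemma hensel (K : fieldType) (g : {poly {poly K}}) m :
  g.[0].[0] = 0 -> g^`().[0].[0] != 0 ->
  exists beta, 'X^m %| g.[beta].
Proof.
move=> g0 d0.
suff [b [b0 bm]] : exists b : {poly K}, b.[0] = 0 /\ 'X^(m.+1) %| g.[b].
  by exists b; apply: dvdp_trans bm; rewrite exprS dvdp_mull.
elim: m => [|m [b [b0 /dvdpP [h gb]]]].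
  exists 0; split; first exact: horner0.
  by rewrite expr1 dvdX g0.
set d := g^`().[0].[0] in d0.
(* The correction [e] cancels the term of lowest order of [g.[b]]. *)
pose c := h.[0] / d; pose e : {poly K} := - (c%:P * 'X^(m.+1)).
exists (b + e); split.
  by rewrite /e !hornerE b0 expr0n mulr0 oppr0 addr0.
have [h2 ->] := horner_taylor2 g b e.
have -> : g.[b] + g^`().[b] * e + h2 * e ^+ 2 =
    (h - g^`().[b] * c%:P + h2 * c%:P ^+ 2 * 'X^(m.+1)) * 'X^(m.+1).
  by rewrite gb /e; ring.
rewrite [X in X %| _]exprS dvdp_mul // dvdX.
rewrite !(hornerD, hornerN, hornerM, hornerC, hornerXn) (horner_horner _ b) b0.
by rewrite exprS mul0r mulr0 addr0 -/d /c mulrC divfK // subrr.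
Qed.

Lemma dvdXn_mul (K : fieldType) (p q : {poly K}) m :
  'X^(m + m) %| p * q -> ('X^m %| p) || ('X^m %| q).
Proof.
have [->|pN0] := eqVneq p 0; first by rewrite dvdp0.
have [->|qN0] := eqVneq q 0; first by rewrite dvdp0 orbT.
have [i [p1]] := multiplicity_XsubC p 0; rewrite pN0 subr0 /= => p1r ->.
have [j [q1]] := multiplicity_XsubC q 0; rewrite qN0 subr0 /= => q1r ->.
have [mi _|im] := leqP m i; first by rewrite dvdp_mull ?dvdp_exp2l.
have [mj _|jm] := leqP m j; first by rewrite orbC dvdp_mull ?dvdp_exp2l.
rewrite mulrACA -exprD => /(dvdp_trans _) dv.
have := dv 'X^((i + j).+1); rewrite dvdp_exp2l; last first.
  by rewrite -addSn leq_add // ltnW.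
move=> /(_ isT); rewrite exprS dvdp_mul2r ?expf_neq0 ?polyX_eq0 //.
by rewrite dvdX hornerM mulf_eq0 (negPf (p1r : p1.[0] != 0))
  (negPf (q1r : q1.[0] != 0)).
Qed.

(** A linear form that does not kill the leading coefficient of [P] turns [P]
into a nonzero [PK] over [K], which is generically coprime to the irreducible
[g].  As the form is [K]-linear, [PK.[beta]] inherits the divisibility of
[P.[map_poly f beta]], and the Bezout relation evaluated at [beta] makes
['X^m] divide a fixed nonzero polynomial, which bounds [m]. *)
Lemma linear_form_coprime (K L : fieldType) (f : {rmorphism K -> L})
    (g : {poly {poly K}}) (P : {poly {poly L}}) :
  g \is monic -> (1 < size g)%N -> fract_irreducible g ->
  P != 0 -> (size P < size g)%N ->
  exists s, forall m beta, (s <= m)%N -> 'X^m %| g.[beta] ->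
    ~~ ('X^m %| P.[map_poly f beta]).
Proof.
move=> gm g1 irr PN0 sP.
have lN0 : lead_coef (lead_coef P) != 0 by rewrite !lead_coef_eq0.
have [phi [phiM phil]] := exists_linear_form f lN0.
have phiM2 := semilinear_map_poly phiM.
pose Phi : {additive {poly L} -> {poly K}} := map_poly phi.
have PhiM b a : Phi (b * map_poly f a) = Phi b * a by exact: phiM2.
pose PK := map_poly Phi P.
have PKN0 : PK != 0.
  apply: contraNneq phil => PK0.
  have : (PK`_(size P).-1)`_(size (lead_coef P)).-1 = 0 by rewrite PK0 !coef0.
  by rewrite coef_map_id0 ?raddf0 // coef_map_id0 ?raddf0 // -!lead_coefE => ->.
have [[q PKE]|[U [V [r [rN0 rE]]]]] := dvd_or_coprime PK gm g1 irr.
  have qN0 : q != 0 by apply: contraNneq PKN0 => q0; rewrite PKE q0 mul0r.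
  have : (size PK < size g)%N := leq_ltn_trans (size_poly _ _) sP.
  by rewrite PKE size_Mmonic // (polySpred qN0) addSn /= ltnNge leq_addl.
exists (size r) => m b sm gb; apply/negP => /dvdpP [h Pb].
have PKb : 'X^m %| PK.[b].
  rewrite (semilinear_horner PhiM) Pb -(map_polyXn f) PhiM.
  exact: dvdp_mulIr.
have : 'X^m %| r.
  rewrite -(hornerC r b) rE !(hornerD, hornerM).
  by apply: dvdp_add; apply: dvdp_mull.
by move/(dvdp_leq rN0); rewrite size_polyXn ltnNge sm.
Qed.

(** A proper factorization over [L] would make one factor vanish to high order
along the approximate roots of [g] at the smooth [K]-rational point [(0, 0)],
which [linear_form_coprime] excludes.  Without a smooth rational point the
statement fails, as for ['Y^2 + 'X^2] over the rationals. *)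
Lemma fract_irreducible_extension (K L : fieldType) (f : {rmorphism K -> L})
    (g : {poly {poly K}}) :
  g \is monic -> (1 < size g)%N -> fract_irreducible g ->
  g.[0].[0] = 0 -> g^`().[0].[0] != 0 ->
  fract_irreducible (map_poly (map_poly f) g).
Proof.
move=> gm g1 irr g0 d0 c P Q cN0 cE.
have fgm : map_poly (map_poly f) g \is monic by rewrite monic_map.
have cgN0 : c *: map_poly (map_poly f) g != 0.
  by rewrite scale_poly_eq0 negb_or cN0 monic_neq0.
move: (cgN0); rewrite cE mulf_eq0 negb_or => /andP[PN0 QN0].
rewrite size_map_poly_id0; last by rewrite (eqP gm) rmorph1 oner_neq0.
move=> sP sQ.
have [s1 s1P] := linear_form_coprime f gm g1 irr PN0 sP.
have [s2 s2P] := linear_form_coprime f gm g1 irr QN0 sQ.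
pose m := maxn s1 s2.
have [b gb] := hensel (m + m) g0 d0.
have gbm : 'X^m %| g.[b] by apply: dvdp_trans gb; rewrite dvdp_exp2l ?leq_addl.
have : 'X^(m + m) %| P.[map_poly f b] * Q.[map_poly f b].
  rewrite -hornerM -cE hornerZ dvdp_mull //.
  by rewrite horner_map -(map_polyXn f) dvdp_map.
move=> /dvdXn_mul /orP[]; apply/negP.
  by apply: s1P => //; exact: leq_maxl.
by apply: s2P => //; exact: leq_maxr.
Qed.

(** * Clearing denominators *)

Section Denominators.
Variables (A B : idomainType) (f : {rmorphism A -> B}).
Hypothesis fracf : forall b, exists d a, d != 0 /\ f d * b = f a.

Lemma clear_denominators (p : {poly B}) :
  exists d q, d != 0 /\ f d *: p = map_poly f q.
Proof.
elim/poly_ind: p => [|p c [d [q [dN0 dq]]]].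
  by exists 1, 0; rewrite scaler0 rmorph0 oner_neq0.
have [e [a [eN0 ea]]] := fracf c.
exists (d * e), ((e *: q) * 'X + (d * a)%:P); rewrite mulf_neq0 //; split=> //.
rewrite [RHS]rmorphD [X in _ = X + _]rmorphM /= map_polyZ /= map_polyX.
rewrite map_polyC /= !rmorphM -dq -ea -!mul_polyC !polyCM; ring.
Qed.

Lemma fract_irreducible_fraction (g : {poly A}) : injective f ->
  fract_irreducible g -> fract_irreducible (map_poly f g).
Proof.
move=> finj irr c P Q cN0 cE sP sQ.
have f0 x : (f x == 0) = (x == 0) by rewrite -(rmorph0 f) (inj_eq finj).
have [d1 [c0 [d1N0 cc0]]] := fracf c.
have [d2 [P0 [d2N0 PP0]]] := clear_denominators P.
have [d3 [Q0 [d3N0 QQ0]]] := clear_denominators Q.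
have smap (p : {poly A}) : size (map_poly f p) = size p.
  by apply: size_map_inj_poly; rewrite ?rmorph0.
rewrite !smap in sP sQ.
apply: (irr (d2 * d3 * c0) (d1 *: P0) Q0).
- by rewrite !mulf_neq0 // -f0 -cc0 mulf_neq0 ?f0.
- apply: (map_inj_poly finj (rmorph0 f)).
  rewrite rmorphM /= !map_polyZ /= -PP0 -QQ0 !rmorphM -cc0.
  rewrite -!scalerAl -!scalerAr scalerA -[P * Q]cE !scalerA.
  by congr (_ *: _); ring.
- by rewrite size_scale // -smap -PP0 size_scale ?f0.
- by rewrite -smap -QQ0 size_scale ?f0.
Qed.
End Denominators.

(** * The polynomials of the critical orbit *)

Lemma monicDl (A : nzRingType) (p q : {poly A}) :
  p \is monic -> (size q < size p)%N ->
  p + q \is monic /\ size (p + q) = size p.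
Proof.
by move=> pm qp; rewrite monicE lead_coefDl // -monicE pm size_polyDl.
Qed.

(** In [{poly {poly A}}] the outer variable is [b] and the inner one is [a].
The orbit of [0] under [w^3 + 3 a w^2 + b] is [b * orbit_poly A n]. *)
Fixpoint orbit_poly (A : comNzRingType) (n : nat) : {poly {poly A}} :=
  if n is m.+1 then
    'X^2 * orbit_poly A m ^+ 3 +
    3%:R * 'X%:P * 'X * orbit_poly A m ^+ 2 + 1
  else 0.

(** The cofactor in [orbit_step_factor]. *)
Definition prefixed_poly (A : comNzRingType) (n : nat) : {poly {poly A}} :=
  let y := orbit_poly A n.+1 in let z := orbit_poly A n in
  'X * (y ^+ 2 + y * z + z ^+ 2) + 3%:R * 'X%:P * (y + z).

Section OrbitPoly.
Variable A : comNzRingType.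
Local Notation y_ := (orbit_poly A).

Lemma orbit_polyS n :
  y_ n.+1 = 'X^2 * y_ n ^+ 3 + 3%:R * 'X%:P * 'X * y_ n ^+ 2 + 1.
Proof. by []. Qed.

Lemma map_orbit_poly (B : comNzRingType) (f : {rmorphism A -> B}) n :
  map_poly (map_poly f) (y_ n) = orbit_poly B n.
Proof.
elim: n => [|n IH] /=; first by rewrite rmorph0.
rewrite !(rmorphD, rmorphM, rmorphXn, rmorph1, rmorph_nat) /= IH.
by rewrite map_polyX map_polyC /= map_polyX.
Qed.

Lemma map_prefixed_poly (B : comNzRingType) (f : {rmorphism A -> B}) n :
  map_poly (map_poly f) (prefixed_poly A n) = prefixed_poly B n.
Proof.
rewrite /prefixed_poly -!(map_orbit_poly f).
rewrite !(rmorphD, rmorphM, rmorphXn, rmorph_nat) /=.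
by rewrite map_polyX map_polyC /= map_polyX.
Qed.

Lemma orbit_poly_at0 n : (y_ n).[0] = (0 < n)%:R.
Proof.
case: n => [|n] /=; first by rewrite horner0.
by rewrite !(hornerD, hornerM, hornerX, hornerC) !(mulr0, mul0r, add0r).
Qed.

Lemma prefixed_poly_at0 n :
  (prefixed_poly A n).[0] = 3%:R * ('X *+ (0 < n).+1).
Proof.
have := orbit_poly_at0 n; have := orbit_poly_at0 n.+1; rewrite /prefixed_poly.
move: (y_ n.+1) (y_ n) => y z yE zE.
rewrite !(hornerD, hornerM, hornerX, hornerC) yE zE.
by case: n {zE yE} => [|n] /=; ring.
Qed.

(** Where [3] is nonzero, this and [prefixed_poly_at0] make the origin a smooth
point of the curve, with a tangent transverse to the [b]-axis. *)
Lemma deriv_prefixed_poly_at0 n :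
  (prefixed_poly A n)^`().[0].[0] = if n is 0 then 1 else 3%:R.
Proof.
have := orbit_poly_at0 n; have := orbit_poly_at0 n.+1; rewrite /prefixed_poly.
move: (y_ n.+1) (y_ n) => y z yE zE.
rewrite -polyC_natr !derivE !(hornerD, hornerM, hornerX, hornerC, horner_exp).
rewrite yE zE -!polyC_natr !hornerC.
by case: n {zE yE} => [|n] /=; ring.
Qed.

End OrbitPoly.

Section OrbitPolySize.
Variable A : idomainType.
Local Notation y_ := (orbit_poly A).

Lemma monic_orbit_poly n : y_ n.+1 \is monic /\ size (y_ n.+1) = (3 ^ n)%N.
Proof.
elim: n => [|n [ym ys]].
  by rewrite /= !expr0n !mulr0 !add0r monic1 size_poly1.
have s0 : (0 < 3 ^ n)%N by rewrite expn_gt0.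
have yN0 := monic_neq0 ym.
have sX k : size (y_ n.+1 ^+ k) = ((3 ^ n).-1 * k).+1.
  by rewrite -ys -size_exp prednK // size_poly_gt0 expf_neq0.
have Pm : 'X^2 * y_ n.+1 ^+ 3 \is monic by rewrite monicMl ?monicXn ?monic_exp.
have Ps : size ('X^2 * y_ n.+1 ^+ 3) = (3 ^ n.+1)%N.
  rewrite mulrC size_mulXn ?monic_neq0 ?monic_exp // sX expnS.
  by case: (3 ^ n)%N s0 => // m _; rewrite -pred_Sn; ring.
have -> : y_ n.+2 = 'X^2 * y_ n.+1 ^+ 3 +
    ((3%:R * 'X) *: (y_ n.+1 ^+ 2 * 'X) + 1).
  by rewrite -mul_polyC polyCM polyC_natr /=; ring.
rewrite -Ps; apply: monicDl => //; rewrite Ps.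
apply: leq_ltn_trans (size_polyD _ _) _; rewrite gtn_max size_poly1.
rewrite (leq_ltn_trans (size_scale_leq _ _)) ?size_mulX ?expf_neq0 // ?sX.
  by rewrite -[X in (X < _)%N](expn0 3) ltn_exp2l.
by rewrite expnS; case: (3 ^ n)%N s0 => // m _; rewrite -pred_Sn; lia.
Qed.

Lemma size_orbit_poly_lt n : (size (y_ n) < size (y_ n.+1))%N.
Proof.
have [_ ->] := monic_orbit_poly n; case: n => [|n].
  by rewrite size_poly0.
by have [_ ->] := monic_orbit_poly n; rewrite ltn_exp2l.
Qed.

Lemma monic_prefixed_poly n :
  prefixed_poly A n \is monic /\ size (prefixed_poly A n) = (2 * 3 ^ n)%N.
Proof.
have [ym ys] := monic_orbit_poly n; have yz := size_orbit_poly_lt n.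
rewrite /prefixed_poly; move: (y_ n.+1) (y_ n) ym ys yz => y z ym ys yz.
have yN0 := monic_neq0 ym.
have Ps : size (y ^+ 2 * 'X) = (2 * 3 ^ n)%N.
  rewrite size_mulX ?expf_neq0 // -ys.
  have e : ((size y).-1 * 2).+1 = size (y ^+ 2).
    by rewrite -size_exp prednK // size_poly_gt0 expf_neq0.
  by rewrite -e -(prednK (_ : 0 < size y)%N) ?size_poly_gt0 // -pred_Sn; lia.
have -> : 'X * (y ^+ 2 + y * z + z ^+ 2) + 3%:R * 'X%:P * (y + z) =
    y ^+ 2 * 'X + ((y + z) * z * 'X + (3%:R * 'X) *: (y + z)).
  by rewrite -mul_polyC polyCM polyC_natr; ring.
have Pm : y ^+ 2 * 'X \is monic by rewrite monicMl ?monic_exp ?monicX.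
rewrite -Ps; apply: monicDl => //; rewrite Ps.
have yzs : size (y + z) = (3 ^ n)%N by rewrite size_polyDl.
apply: leq_ltn_trans (size_polyD _ _) _; rewrite gtn_max; apply/andP; split.
  apply: leq_ltn_trans (size_polyMleq _ _) _; rewrite size_polyX addn2 /=.
  apply: leq_ltn_trans (_ : ((3 ^ n + size z).-1.+1 < _)%N).
    by rewrite ltnS -yzs; exact: size_polyMleq.
  by rewrite ys in yz; lia.
apply: leq_ltn_trans (size_scale_leq _ _) _; rewrite yzs.
by have : (0 < 3 ^ n)%N; [rewrite expn_gt0 | lia].
Qed.

Lemma size_orbit_step n : size ('X * (y_ n.+1 - y_ n)) = (3 ^ n).+1.
Proof.
have [ym ys] := monic_orbit_poly n; have yz := size_orbit_poly_lt n.
have s : size (y_ n.+1 - y_ n) = (3 ^ n)%N by rewrite size_polyDl ?size_polyN.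
by rewrite mulrC size_mulX ?s // -size_poly_gt0 s expn_gt0.
Qed.

(** Cubing is additive in characteristic [3], so each step of the orbit is the
cube of the previous one. *)
Lemma orbit_step_char3 n : 3%:R = 0 :> A ->
  'X * (y_ n.+1 - y_ n) = 'X^(3 ^ n).
Proof.
move=> A3; have P3 : 3%:R = 0 :> {poly {poly A}} by rewrite -!polyC_natr A3.
elim: n => [|n IH]; first by rewrite /= expn0; ring.
have [yE zE] := (orbit_polyS A n.+1, orbit_polyS A n).
rewrite expnSr exprM -IH yE {3}zE.
move: (y_ n.+1) (y_ n) => y z; apply/eqP; rewrite -subr_eq0; apply/eqP.
transitivity (3%:R * ('X^3 * (y ^+ 2 * z - y * z ^+ 2) +
                      'X%:P * 'X^2 * (y ^+ 2 - z ^+ 2))); first by ring.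
by rewrite P3 mul0r.
Qed.

Lemma prefixed_poly_char3 n : 3%:R = 0 :> A ->
  prefixed_poly A n = 'X^((2 * 3 ^ n).-1).
Proof.
move=> A3; have P3 : 3%:R = 0 :> {poly {poly A}} by rewrite -!polyC_natr A3.
have XN0 : 'X != 0 :> {poly {poly A}} by rewrite polyX_eq0.
apply: (mulfI XN0); rewrite -exprS prednK ?muln_gt0 ?expn_gt0 //.
rewrite mulnC exprM -(orbit_step_char3 n A3) /prefixed_poly.
move: (y_ n.+1) (y_ n) => y z; apply/eqP; rewrite -subr_eq0; apply/eqP.
transitivity (3%:R * ('X^2 * y * z + 'X * 'X%:P * (y + z))); first by ring.
by rewrite P3 mul0r.
Qed.
End OrbitPolySize.

(** Eisenstein's criterion at [3] over [{poly int}], with the absolute value of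
the leading coefficient as the measure, gives irreducibility over the rationals;
the smooth rational origin carries it over to [K]. *)
Lemma fract_irreducible_prefixed_poly (K : fieldType)
    (f : {rmorphism rat -> K}) n :
  fract_irreducible (prefixed_poly K n).
Proof.
have [gm gs] := monic_prefixed_poly int n.
have gZ : fract_irreducible (prefixed_poly int n).
  pose red : {rmorphism {poly int} -> {poly 'F_3}} :=
    map_poly (intr : int -> 'F_3).
  have F3 : 3%:R = 0 :> 'F_3 by apply/val_inj.
  have ker a : red a = 0 -> exists b, a = 3%:R * b.
    move=> /(@poly_divisible _ _ _ 3%:R) [|b ->]; last first.
      by exists b; rewrite -mul_polyC polyC_natr.
    move=> m /eqP; rewrite -(dvdz_pcharf (pchar_Fp (isT : prime 3))).
    move=> /dvdzP [b ->].
    by exists b; rewrite mulrC.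
  apply: (@eisenstein _ _ red 3%:R (fun a => `|lead_coef a|%N) _
     (2 * 3 ^ n).-1 ('X *+ (0 < n).+1) ker) => //.
  - by rewrite rmorph_nat -polyC_natr F3.
  - by rewrite -polyC_natr polyC_eq0.
  - move=> a aN0; rewrite -polyC_natr mul_polyC lead_coefZ.
    by rewrite -lead_coef_eq0 in aN0; lia.
  - by rewrite prednK // muln_gt0 expn_gt0.
  - by rewrite map_prefixed_poly prefixed_poly_char3.
  - exact: prefixed_poly_at0.
  - rewrite rmorphMn /= map_polyX; case: (n) => [|m] /=.
      by rewrite mulr1n polyX_eq0.
    by rewrite -scaler_nat scale_poly_eq0 polyX_eq0 orbF.
have ratE (q : rat) : exists d a : int, d != 0 /\ d%:~R * q = a%:~R.
  by exists (denq q), (numq q); rewrite denq_neq0 numqE mulrC.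
have gQ : fract_irreducible (prefixed_poly rat n).
  rewrite -(map_prefixed_poly intr).
  apply: fract_irreducible_fraction => //.
  - move=> b; have [d [a [dN0 da]]] := clear_denominators ratE b.
    exists d%:P, a; rewrite polyC_eq0; split=> //=.
    by rewrite map_polyC mul_polyC.
  - by move=> p q /=; apply: map_inj_poly => //; exact: intr_inj.
rewrite -(map_prefixed_poly f).
have [hm hs] := monic_prefixed_poly rat n.
apply: fract_irreducible_extension => //.
- by rewrite hs; have : (0 < 3 ^ n)%N; [rewrite expn_gt0|lia].
- rewrite prefixed_poly_at0 hornerM [X in _ * X]hornerMn hornerX.
  by rewrite mul0rn mulr0.
- apply/eqP => e; have := etrans (esym e) (deriv_prefixed_poly_at0 _ n).
  by case: (n).
Qed.

Lemma fract_irreducible_X (A : idomainType) : fract_irreducible ('X : {poly A}).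
Proof.
move=> c P Q cN0 cE; rewrite size_polyX !ltnS => P1 Q1.
move: cE (size_scale 'X cN0); rewrite (size1_polyC P1) (size1_polyC Q1) => ->.
rewrite size_polyX -polyCM => s.
by have := size_polyC_leq1 (P`_0 * Q`_0); rewrite s.
Qed.

(** If the irreducible [prefixed_poly K n] divided the step of the orbit, then
by degrees the quotient would be constant; but at [b = 0] the step vanishes and
[prefixed_poly K n] does not. *)
Lemma prefixed_poly_coprime_step (K : fieldType) n :
  3%:R != 0 :> K -> 2%:R != 0 :> K ->
  fract_irreducible (prefixed_poly K n) ->
  generically_coprime (prefixed_poly K n)
    ('X * (orbit_poly K n.+1 - orbit_poly K n)).
Proof.
move=> K3 K2 irr; have [gm gs] := monic_prefixed_poly K n.
have e3 : (0 < 3 ^ n)%N by rewrite expn_gt0.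
have g1 : (1 < size (prefixed_poly K n))%N by rewrite gs; lia.
have Ds := size_orbit_step K n.
have [[q DE]|//] :=
  dvd_or_coprime ('X * (orbit_poly K n.+1 - orbit_poly K n)) gm g1 irr.
have qN0 : q != 0.
  by apply: contra_eq_neq Ds => q0; rewrite DE q0 mul0r size_poly0.
have q1 : (size q <= 1)%N.
  have : (size q + 2 * 3 ^ n).-1 = (3 ^ n).+1.
    by rewrite -gs -size_Mmonic // -DE Ds.
  by lia.
have [c qE] : exists c, q = c%:P by exists q`_0; exact: size1_polyC.
case/negP: qN0; rewrite qE polyC_eq0.
move/(congr1 (horner^~ 0)): DE; rewrite !hornerM hornerX mul0r qE hornerC.
rewrite prefixed_poly_at0 => /esym/eqP; rewrite mulf_eq0 => /orP[//|].
rewrite mulf_eq0 -polyC_natr polyC_eq0 (negPf K3) /=.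
case: (n) => [|m] /=; first by rewrite mulr1n polyX_eq0.
by rewrite -scaler_nat scale_poly_eq0 polyX_eq0 orbF (negPf K2).
Qed.

(** [f(x) - f(x')] is divisible by [x - x']. *)
Lemma orbit_step_factor (A : comNzRingType) n :
  orbit_poly A n.+2 - orbit_poly A n.+1 =
  'X * (orbit_poly A n.+1 - orbit_poly A n) * prefixed_poly A n.
Proof.
have [yE zE] := (orbit_polyS A n.+1, orbit_polyS A n).
rewrite yE {3}zE /prefixed_poly.
by move: (orbit_poly A n.+1) (orbit_poly A n) => y z; ring.
Qed.

(** * Plane curves over an algebraically closed field *)

Lemma horner2M (A : comNzRingType) (P Q : {poly {poly A}}) a b :
  (P * Q).[b%:P].[a] = P.[b%:P].[a] * Q.[b%:P].[a].
Proof. by rewrite !hornerM. Qed.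

Lemma map_horner2 (A : comNzRingType) (g : {poly {poly A}}) a b :
  (map_poly (horner_eval a) g).[b] = g.[b%:P].[a].
Proof.
have {1}-> : b = horner_eval a b%:P by rewrite /horner_eval hornerC.
by rewrite horner_map.
Qed.

(** Choose [a] outside the zeros of the polynomial [r] of the Bezout relation;
since [g] is monic in [b], it has a zero [b] above this [a]. *)
Lemma curve_point (C : closedFieldType) (g P : {poly {poly C}}) :
  g \is monic -> (1 < size g)%N -> generically_coprime g P ->
  exists a b, g.[b%:P].[a] = 0 /\ P.[b%:P].[a] != 0.
Proof.
move=> gm g1 [U [V [r [rN0 rE]]]].
have [a ra] := closed_nonrootP _ rN0.
have : size (map_poly (horner_eval a) g) != 1.
  rewrite size_map_poly_id0; first by rewrite gtn_eqF.
  by rewrite (eqP gm) rmorph1 oner_neq0.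
move=> /closed_rootP [b /rootP]; rewrite map_horner2 => gab.
exists a, b; split => //; apply: contraNneq ra => Pab.
move: rE => /(congr1 (fun p => p.[b%:P].[a])).
by rewrite hornerC !hornerD !horner2M gab Pab !mulr0 addr0 => /rootP.
Qed.

(** A polynomial that is nonzero somewhere on the curve is not divisible by [g],
hence is generically coprime to it. *)
Lemma irreducible_curve (C : closedFieldType) (g D G1 G2 : {poly {poly C}})
    a1 b1 a2 b2 :
  g \is monic -> (1 < size g)%N -> fract_irreducible g ->
  generically_coprime g D ->
  g.[b1%:P].[a1] = 0 -> G1.[b1%:P].[a1] != 0 ->
  g.[b2%:P].[a2] = 0 -> G2.[b2%:P].[a2] != 0 ->
  exists a b, [/\ g.[b%:P].[a] = 0, D.[b%:P].[a] != 0,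
    G1.[b%:P].[a] != 0 & G2.[b%:P].[a] != 0].
Proof.
move=> gm g1 irr cD z1 n1 z2 n2.
have cop G a b : g.[b%:P].[a] = 0 -> G.[b%:P].[a] != 0 ->
    generically_coprime g G.
  move=> z n; have [[q GE]|//] := dvd_or_coprime G gm g1 irr.
  by rewrite GE horner2M z mulr0 eqxx in n.
have cG := generically_coprimeM (cop _ _ _ z1 n1) (cop _ _ _ z2 n2).
have [a [b [gab]]] := curve_point gm g1 (generically_coprimeM cD cG).
by rewrite !horner2M !mulf_eq0 !negb_or => /and3P[? ? ?]; exists a, b.
Qed.

(** * Preperiodicity to a fixed point *)

Lemma preperiodic_to_cycle_conj (T U : Type) (h : T -> U) (f : T -> T)
    (f' : U -> U) k n z :
  injective h -> (forall x, h (f x) = f' (h x)) ->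
  preperiodic_to_cycle f k n z -> preperiodic_to_cycle f' k n (h z).
Proof.
move=> hI hf; have hit m x : iter m f' (h x) = h (iter m f x).
  by elim: m => //= m ->.
have perE m x : has_period f' m (h x) <-> has_period f m x.
  split; case=> m0 e ne; split=> //.
  - by apply: hI; rewrite -hit.
  - by move=> j /ne nej e'; apply: nej; rewrite hit e'.
  - by rewrite hit e.
  - by move=> j /ne nej; rewrite hit => /hI.
move=> [[[m pm] np] pn]; split; last by rewrite hit; apply/perE.
split; first by exists m; rewrite hit; apply/perE.
by move=> j /np nj [l]; rewrite hit => /perE pl; apply: nj; exists l.
Qed.

Lemma has_period1 (T : Type) (f : T -> T) z : has_period f 1 z <-> f z = z.
Proof.
split; first by case.
by move=> fz; split => // m; case: m => // m; rewrite ltnS ltn0.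
Qed.

Lemma preperiodic_to_fixed0 (T : Type) (f : T -> T) z :
  preperiodic_to_cycle f 0 1 z <-> f z = z.
Proof.
split; first by case=> _ /has_period1.
by move=> fz; split; [split => //; exists 1%N|]; apply/has_period1.
Qed.

(** A periodic point whose orbit meets a fixed point is that fixed point, so
only the last point before the fixed one has to be checked. *)
Lemma preperiodic_to_fixedS (T : Type) (f : T -> T) k z :
  preperiodic_to_cycle f k.+1 1 z <->
  iter k.+2 f z = iter k.+1 f z /\ iter k.+1 f z <> iter k f z.
Proof.
split.
  case=> -[_ np] /has_period1 fix1; split => // e.
  by apply: (np k) => //; exists 1%N; apply/has_period1; exact: e.
move=> [fix1 ne].
have fixi m : iter m f (iter k.+1 f z) = iter k.+1 f z.
  by elim: m => //= m ->.
split; last by apply/has_period1.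
split; first by exists 1%N; apply/has_period1.
move=> j jk [n [n0 per _]]; apply: ne.
have perm m : iter (m * n) f (iter j f z) = iter j f z.
  by elim: m => // m IH; rewrite mulSn iterD IH.
have jE : iter j f z = iter k.+1 f z.
  (* After [k.+1] turns around its cycle, the orbit has met the fixed point. *)
  rewrite -(perm k.+1) -iterD.
  have -> : (k.+1 * n + j = (k.+1 * n + j - k.+1) + k.+1)%N.
    by rewrite subnK //; nia.
  by rewrite iterD fixi.
have e m : (j <= m)%N -> iter m f z = iter k.+1 f z.
  by move=> jm; rewrite -(subnK jm) iterD jE fixi.
by rewrite e // e.
Qed.

(** * Cubic polynomials with a marked critical point *)

Section Marked.
Variable R : realType.
Local Notation C := R[i].

(** The conjugate of [w^3 + 3 a w^2 + b] by the translation [w + a]; its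
critical point [a] corresponds to [w = 0]. *)
Definition marked_cubic (a b : C) : cubic R :=
  centered (- (3%:R * a ^+ 2)) (2%:R * a ^+ 3 + a + b).

Lemma horner_marked_cubic a b w :
  (val (marked_cubic a b)).[a + w] = a + (w ^+ 3 + 3%:R * a * w ^+ 2 + b).
Proof.
rewrite /= !(hornerD, hornerZ, hornerX, hornerXn, hornerC); ring.
Qed.

Lemma iter_marked_cubic a b n :
  iter n (horner (val (marked_cubic a b))) a =
  a + b * (orbit_poly C n).[b%:P].[a].
Proof.
elim: n => [|n IH]; first by rewrite /= !horner0 mulr0 addr0.
rewrite iterS IH horner_marked_cubic orbit_polyS -polyC_natr.
by rewrite !(hornerD, hornerM, hornerX, hornerXn, hornerC, horner_exp); ring.
Qed.

Lemma deriv_centered (A B z : C) :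
  (val (centered A B))^`().[z] = 3%:R * z ^+ 2 + A.
Proof.
rewrite /= !derivD derivZ derivX derivC derivXn addr0 alg_polyC.
by rewrite hornerD hornerMn hornerXn hornerC mulr_natl.
Qed.

Lemma marked_cubic_critical a b : critical_point (val (marked_cubic a b)) a.
Proof. by apply/rootP; rewrite deriv_centered subrr. Qed.

Lemma preperiodic_locus_marked k n c :
  preperiodic_locus R k n c <->
  exists a b, c = P3_class (marked_cubic a b) /\
    preperiodic_to_cycle (horner (val (marked_cubic a b))) k n a.
Proof.
split; last first.
  move=> [a [b [-> pre]]]; exists (marked_cubic a b); split => //.
  by exists a; split => //; exact: marked_cubic_critical.
move=> [p [-> [z [crit pre]]]].
have [A [B AB]] := P3_centered (P3_class p).
have /P3_classP [u [v [uN0 uv]]] := AB.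
pose h x := u * x + v.
have hI : injective h by move=> x y /addIr /(mulfI uN0).
have hE x : h x = (u *: 'X + v%:P).[x] by rewrite !hornerE.
have hf x : h (val p).[x] = (val (centered A B)).[h x].
  by rewrite !hE -!horner_comp uv.
have := preperiodic_to_cycle_conj hI hf pre.
have : critical_point (val (centered A B)) (h z).
  move/(congr1 (fun q => q^`().[z])): uv; rewrite !deriv_comp !hornerM.
  have -> : (u *: 'X + v%:P)^`() = u%:P.
    by rewrite derivD derivZ derivX derivC addr0 alg_polyC.
  move: crit => /rootP ->; rewrite mulr0 horner_comp -hE hornerC => /eqP.
  by rewrite mulf_eq0 (negPf uN0) orbF.
move: (h z) => a ca pa.
have AE : A = - (3%:R * a ^+ 2).
  move/rootP: ca; rewrite deriv_centered addrC => /eqP.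
  by rewrite addr_eq0 => /eqP.
exists a, (B - (2%:R * a ^+ 3 + a)).
have -> : marked_cubic a (B - (2%:R * a ^+ 3 + a)) = centered A B.
  by rewrite /marked_cubic -AE addrC subrK.
by [].
Qed.

Lemma preperiodic_marked0 a b :
  preperiodic_to_cycle (horner (val (marked_cubic a b))) 0 1 a <-> b = 0.
Proof.
have fa : (val (marked_cubic a b)).[a] = a + b.
  by have := horner_marked_cubic a b 0; rewrite addr0 => ->; ring.
apply: iff_trans (preperiodic_to_fixed0 _ _) _; rewrite fa.
split=> [e|->]; last by rewrite addr0.
by apply: (addrI a); rewrite addr0.
Qed.

Lemma preperiodic_markedS n a b :
  preperiodic_to_cycle (horner (val (marked_cubic a b))) n.+1 1 a <->
  (prefixed_poly C n).[b%:P].[a] = 0 /\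
  ('X * (orbit_poly C n.+1 - orbit_poly C n)).[b%:P].[a] != 0.
Proof.
apply: iff_trans (preperiodic_to_fixedS _ _ _) _; rewrite !iter_marked_cubic.
have step m : ('X * (orbit_poly C m.+1 - orbit_poly C m)).[b%:P].[a] =
    (a + b * (orbit_poly C m.+1).[b%:P].[a]) -
    (a + b * (orbit_poly C m).[b%:P].[a]).
  by rewrite horner2M hornerD hornerN hornerX hornerC !(hornerD, hornerN); ring.
have stepM : ('X * (orbit_poly C n.+2 - orbit_poly C n.+1)).[b%:P].[a] =
    b * (('X * (orbit_poly C n.+1 - orbit_poly C n)).[b%:P].[a] *
    (prefixed_poly C n).[b%:P].[a]).
  by rewrite orbit_step_factor 2!horner2M hornerX hornerC.
split.
  move=> [e ne].
  have Dn : ('X * (orbit_poly C n.+1 - orbit_poly C n)).[b%:P].[a] != 0.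
    by rewrite step subr_eq0; apply/eqP.
  split=> //; move: stepM; rewrite step e subrr => /esym/eqP.
  rewrite !mulf_eq0 (negPf Dn) /= => /orP[/eqP b0|/eqP //].
  by move: Dn; rewrite horner2M hornerX hornerC b0 mul0r eqxx.
move=> [g0 Dn]; split.
  by apply/eqP; rewrite -subr_eq0 -step stepM g0 !mulr0.
by apply/eqP; rewrite -subr_eq0 -step.
Qed.

Lemma pullback (F : {poly {poly C}}) :
  exists G : {poly {poly C}}, forall a b,
    G.[b%:P].[a] =
    F.[((2%:R * a ^+ 3 + a + b) ^+ 2)%:P].[- (3%:R * a ^+ 2)].
Proof.
elim/poly_ind: F => [|F c [G GE]].
  by exists 0 => a b; rewrite !horner0.
pose T : {poly {poly C}} := 2%:R * 'X%:P ^+ 3 + 'X%:P + 'X.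
pose s : {poly C} := - (3%:R * 'X ^+ 2).
exists (G * T ^+ 2 + (c \Po s)%:P) => a b.
have TE : T.[b%:P].[a] = 2%:R * a ^+ 3 + a + b.
  rewrite /T -!polyC_natr -polyC_exp -polyCM !hornerD !hornerC hornerX.
  by rewrite hornerM hornerC hornerXn hornerX hornerC.
have sE : s.[a] = - (3%:R * a ^+ 2).
  by rewrite /s -polyC_natr hornerN hornerM hornerC hornerXn.
rewrite hornerD hornerD hornerC horner_comp sE horner2M GE.
by rewrite horner_exp horner_exp TE hornerMXaddC hornerD hornerM hornerC.
Qed.

(** A relatively closed proper subset of [S] misses some point of the curve, so
it is contained in the zero set of a pulled back polynomial that is nonzero
there.  By [irreducible_curve], two such subsets cannot cover [S]. *)
Lemma zariski_irreducible_param (S : set (P3 R)) (g D : {poly {poly C}}) :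
  g \is monic -> (1 < size g)%N -> fract_irreducible g ->
  generically_coprime g D ->
  (forall c, S c <-> exists a b, c = P3_class (marked_cubic a b) /\
      (g.[b%:P].[a] = 0 /\ D.[b%:P].[a] != 0)) ->
  zariski_irreducible S.
Proof.
move=> gm g1 irr cD SE.
have param a b : g.[b%:P].[a] = 0 -> D.[b%:P].[a] != 0 ->
    S (P3_class (marked_cubic a b)).
  by move=> gab Dab; apply/SE; exists a, b.
split.
  have [a [b [gab Dab]]] := curve_point gm g1 cD.
  by exists (P3_class (marked_cubic a b)); exact: param.
move=> [Y1 [Y2 [[Z1 [I1 Z1E] ->] [Z2 [I2 Z2E] ->] p1 p2 SU]]].
have sep Z I : (forall A B, Z (P3_class (centered A B)) <->
      forall F, I F -> F.[(B ^+ 2)%:P].[A] = 0) ->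
    (S `&` Z `<` S)%classic ->
    exists G : {poly {poly C}},
      (exists a b, g.[b%:P].[a] = 0 /\ G.[b%:P].[a] != 0) /\
      forall a b, Z (P3_class (marked_cubic a b)) -> G.[b%:P].[a] = 0.
  move=> ZE [_ nsub].
  have [c [Sc nZc]] : exists c, S c /\ ~ Z c.
    apply: contrapT => h; apply: nsub => c Sc; split => //.
    by apply: contrapT => nZ; apply: h; exists c.
  move/SE: Sc nZc => [a [b [-> [gab Dab]]]] nZ.
  have [F [IF Fab]] : exists F, I F /\
      F.[((2%:R * a ^+ 3 + a + b) ^+ 2)%:P].[- (3%:R * a ^+ 2)] <> 0.
    apply: contrapT => h; apply/nZ/ZE => F IF.
    by apply: contrapT => nF; apply: h; exists F.
  have [G GE] := pullback F; exists G; split.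
    by exists a, b; split => //; rewrite GE; apply/eqP.
  by move=> a' b' /ZE Z'; rewrite GE; exact: Z'.
have [G1 [[a1 [b1 [z1 n1]]] G1Z]] := sep _ _ Z1E p1.
have [G2 [[a2 [b2 [z2 n2]]] G2Z]] := sep _ _ Z2E p2.
have [a [b [gab Dab n1' n2']]] := irreducible_curve gm g1 irr cD z1 n1 z2 n2.
have := param a b gab Dab; rewrite SU => -[] [_].
  by move/G1Z/eqP; rewrite (negPf n1').
by move/G2Z/eqP; rewrite (negPf n2').
Qed.

End Marked.

Theorem theorem1 (R : realType) (k : nat) :
  zariski_irreducible (preperiodic_locus R k 1).
Proof.
have locus g D :
    (forall a b,
      preperiodic_to_cycle (horner (val (marked_cubic a b))) k 1 a <->
      g.[b%:P].[a] = 0 /\ D.[b%:P].[a] != 0) ->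
    forall c, preperiodic_locus R k 1 c <->
      exists a b, c = P3_class (marked_cubic a b) /\
        (g.[b%:P].[a] = 0 /\ D.[b%:P].[a] != 0).
  move=> E c; split.
    by move=> /preperiodic_locus_marked [a [b [cE /E]]]; exists a, b.
  move=> [a [b [cE gD]]]; apply/preperiodic_locus_marked; exists a, b.
  by split=> //; apply/E.
case: k locus => [|n] locus.
  apply: (@zariski_irreducible_param _ _ 'X 1).
  - exact: monicX.
  - by rewrite size_polyX.
  - exact: fract_irreducible_X.
  - exact: generically_coprime1.
  apply: locus => a b; rewrite hornerX !hornerC oner_neq0.
  by apply: iff_trans (preperiodic_marked0 a b) _; split=> [|[]].
have [gm gs] := monic_prefixed_poly R[i] n.
have irr := @fract_irreducible_prefixed_poly R[i] (ratr : rat -> R[i]) n.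
apply: (zariski_irreducible_param gm _ irr).
- by rewrite gs; have : (0 < 3 ^ n)%N; [rewrite expn_gt0|lia].
- by apply: prefixed_poly_coprime_step => //; rewrite pnatr_eq0.
by apply: locus => a b; exact: preperiodic_markedS.
Qed.
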